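(* For every integer $j \geq 3$, $$m_j(B, P_2) = \begin{cases} 2 & \text{if } j \in \{3,4\},\\ 1 & \text{otherwise.}\end{cases}$$
   Context: All graphs are simple. $K_{j\times s}$ denotes the complete multipartite graph with $j$ partite sets, each of size $s$. The Butterfly graph $B$ is the graph on 5 vertices consisting of two copies of the triangle $C_3$ sharing exactly one common vertex. $P_n$ denotes the path on $n$ vertices (so $P_2$ is a single edge). For graphs $B$ and $G$ and an integer $j\ge 2$, the size multipartite Ramsey number $m_j(B,G)$ is the smallest natural number $s$ such that every colouring of the edges of $K_{j\times s}$ with two colours, red and blue, contains a red copy of $B$ or a blue copy of $G$; if no such $s$ exists, $m_j(B,G)=\infty$. *)

(* Defs.v *)
From mathcomp Require Import all_boot.
From mathcomp Require Import boolp.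

Set Implicit Arguments.
Unset Strict Implicit.
Unset Printing Implicit Defensive.

Record sgraph := SGraph {
  vertex : finType;
  adj : rel vertex;
  adj_sym : symmetric adj;
  adj_irr : irreflexive adj }.

Definition multipartite_adj (j s : nat) : rel ('I_j * 'I_s) :=
  fun u v => u.1 != v.1.

Fact multipartite_sym j s : symmetric (@multipartite_adj j s).
Proof. by move=> u v; rewrite /multipartite_adj eq_sym. Qed.

Fact multipartite_irr j s : irreflexive (@multipartite_adj j s).
Proof. by move=> u; rewrite /multipartite_adj eqxx. Qed.

(* K_{j x s}: the vertex (i, k) is the k-th vertex of the i-th partite set. *)
Definition complete_multipartite (j s : nat) : sgraph :=
  SGraph (@multipartite_sym j s) (@multipartite_irr j s).

(* The triangles are {0, 1, 2} and {0, 3, 4}, with common vertex 0. *)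
Definition butterfly_adj : rel 'I_5 := fun x y =>
  (x != y) &&
  (((val x \in [:: 0; 1; 2]) && (val y \in [:: 0; 1; 2])) ||
   ((val x \in [:: 0; 3; 4]) && (val y \in [:: 0; 3; 4]))).

Fact butterfly_sym : symmetric butterfly_adj.
Proof.
move=> x y; rewrite /butterfly_adj eq_sym; congr (_ && (_ || _));
  exact: andbC.
Qed.

Fact butterfly_irr : irreflexive butterfly_adj.
Proof. by move=> x; rewrite /butterfly_adj eqxx. Qed.

Definition butterfly : sgraph := SGraph butterfly_sym butterfly_irr.

Definition path_adj (n : nat) : rel 'I_n := fun x y =>
  (val y == (val x).+1) || (val x == (val y).+1).

Fact path_sym n : symmetric (@path_adj n).
Proof. by move=> x y; rewrite /path_adj orbC. Qed.

Fact path_irr n : irreflexive (@path_adj n).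
Proof. by move=> x; rewrite /path_adj orbb ltn_eqF. Qed.

Definition path_graph (n : nat) : sgraph :=
  SGraph (@path_sym n) (@path_irr n).

Variant colour := Red | Blue.

(* The colour of the edge uv is c [set u; v]; the values of c on sets that are
   not edges are never used. *)
Definition edge_colouring (K : sgraph) := {set vertex K} -> colour.

(* A copy is a subgraph, not necessarily induced. *)
Definition has_copy (K : sgraph) (c : edge_colouring K) (a : colour)
    (H : sgraph) : Prop :=
  exists f : vertex H -> vertex K, injective f /\
    forall x y, adj x y -> adj (f x) (f y) /\ c [set f x; f y] = a.

Definition arrows (K H G : sgraph) : Prop :=
  forall c : edge_colouring K, has_copy c Red H \/ has_copy c Blue G.

(* m_j(H, G), where None stands for infinity. *)
Definition size_ramsey (j : nat) (H G : sgraph) : option nat :=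
  match pselect (exists s, `[< arrows (complete_multipartite j s) H G >]) with
  | left ex_s => Some (ex_minn ex_s)
  | right _ => None
  end.

(* Main.v *)
Require Import Defs.
From mathcomp Require Import all_boot.
From mathcomp Require Import boolp.

(* A colouring without a blue edge is entirely red, so K arrows (H, P_2) exactly
   when K contains H. The butterfly embeds in K_5 and in K_{3x2}, and it has too
   many vertices for K_{3x1} and K_{4x1}. *)

Definition embeds (H K : sgraph) : Prop :=
  exists2 f : vertex H -> vertex K,
    injective f & forall x y, adj x y -> adj (f x) (f y).

Lemma arrows_edge (K H : sgraph) :
  arrows K H (path_graph 2) <-> embeds H K.
Proof.
split=> [arr | [f f_inj f_adj] c].
  (* Under the constant red colouring, a red copy of [H] is just an embedding, and a blue [P_2]
     would force [Red = Blue]. *)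
  case: (arr (fun=> Red)) => -[f [f_inj f_adj]].
    by exists f => // x y /f_adj[].
  have edge01 : @adj (path_graph 2) ord0 ord_max by [].
  by case: (f_adj _ _ edge01).
case: (pselect (exists u v : vertex K, adj u v /\ c [set u; v] = Blue)).
  case=> u [v [adj_uv c_uv]]; right.
  have adj_vu : adj v u by rewrite adj_sym.
  have neq_uv : u <> v by move=> eq_uv; rewrite eq_uv adj_irr in adj_uv.
  (* The ends of the blue edge form the copy of [P_2]; it is injective because [adj] is
     irreflexive. *)
  exists (fun i : 'I_2 => if i == ord0 then u else v); split=> [|x y].
    by case=> [[|[|i]] lt_i] [[|[|k]] lt_k] //= => [_|/esym|_] //;
       apply: val_inj.
  case: x y => [[|[|i]] lt_i] [[|[|k]] lt_k] //= _; split=> //.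
  by rewrite setUC.
move=> no_blue; left; exists f; split=> // x y /f_adj adj_xy; split=> //.
by case E: (c _) => //; case: no_blue; exists (f x), (f y).
Qed.

Lemma embeds_card (H K : sgraph) : embeds H K -> #|vertex H| <= #|vertex K|.
Proof. by case=> f /leq_card. Qed.

Lemma size_ramsey_eq (j n : nat) (H G : sgraph) :
  arrows (complete_multipartite j n) H G ->
  (forall s, arrows (complete_multipartite j s) H G -> n <= s) ->
  size_ramsey j H G = Some n.
Proof.
move=> arr_n min_n; rewrite /size_ramsey; case: pselect => [ex_s | []].
  case: ex_minnP => m /asboolP arr_m min_m; congr Some; apply/eqP.
  by rewrite eqn_leq min_n // min_m //; apply/asboolP.
by exists n; apply/asboolP.
Qed.

(** With one vertex per part, distinct vertices are always adjacent, so any injection of the five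
    vertices works. *)
Lemma butterfly_embeds_complete (j : nat) :
  5 <= j -> embeds butterfly (complete_multipartite j 1).
Proof.
move=> le5j; exists (fun x : 'I_5 => (widen_ord le5j x, ord0)).
  by move=> x y [] /val_inj.
by move=> x y /andP[].
Qed.

Lemma butterfly_embeds_two (j : nat) :
  3 <= j -> embeds butterfly (complete_multipartite j 2).
Proof.
move=> le3j.
(* The list is a proper 3-colouring of the butterfly: the centre lies alone in part 0, and each
   triangle puts its other two vertices in parts 1 and 2. *)
have part_lt (x : 'I_5) : nth 0 [:: 0; 1; 2; 1; 2] x < 3.
  by case: x => [[|[|[|[|[|x]]]]] lt_x].
(* The boolean [2 < x], read as 0 or 1, tells the two triangles apart and so separates vertices
   sharing a part. *)
have rank_lt (x : 'I_5) : (2 < x) < 2 by case: (2 < x).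
exists (fun x : 'I_5 =>
  (widen_ord le3j (Ordinal (part_lt x)), Ordinal (rank_lt x))).
- move=> x y [] eq_part eq_rank; apply: val_inj; move: eq_part eq_rank.
  by case: x y => [[|[|[|[|[|x]]]]] lt_x] [[|[|[|[|[|y]]]]] lt_y].
- move=> x y; rewrite /= /multipartite_adj -val_eqE /=.
  by case: x y => [[|[|[|[|[|x]]]]] lt_x] [[|[|[|[|[|y]]]]] lt_y].
Qed.

Lemma butterfly_embeds_card (j s : nat) :
  embeds butterfly (complete_multipartite j s) -> 5 <= j * s.
Proof. by move/embeds_card; rewrite /= card_prod !card_ord. Qed.

Theorem theorem3p1 (j : nat) (hj : 3 <= j) :
  size_ramsey j butterfly (path_graph 2) =
  Some (if j \in [:: 3; 4] then 2 else 1).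
Proof.
apply: size_ramsey_eq => [|s]; rewrite arrows_edge.
  case: ifPn => [_|]; first exact: butterfly_embeds_two.
  rewrite !inE => j_neq; apply: butterfly_embeds_complete.
  by move: j hj j_neq => [|[|[|[|[|j]]]]].
move/butterfly_embeds_card; case: ifP => [|_].
  (* For [s <= 1] there are at most 4 vertices, fewer than 5. *)
  by rewrite !inE => /orP[] /eqP->; case: s => [|[]].
by case: s; rewrite ?muln0.
Qed.
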